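(* Let $t\ge1$ and let $\mathbf{s}=(s_1,\ldots,s_r)$ be integers greater than $1$ with $\prod_i s_i=4t+2$, such that $s_1/2, s_2,\ldots,s_r$ are odd integers; let $G=\mathbb{Z}_{s_1}\times\cdots\times\mathbb{Z}_{s_r}$. Let $\phi:G\to\{\pm1\}$ be a binary $\mathbf{s}$-array, let $\mathbf{z}\in\{0,1\}^r$ be a non-zero type vector, and let $D=\{g+K\in E/K\mid \phi'(g)=-1\}$. Then $\phi$ is a GOBA$(\mathbf{s})$ of type $\mathbf{z}$ if and only if $D$ is a relative $(4t+2,2,4t+2,2t+1)$-quasi-difference set in $E/K$ with forbidden subgroup $H/K$. Furthermore, if $z_1=0$ (and these conditions hold) then $D$ is extremal.
   Context: Cyclic groups are written additively. $E=\mathbb{Z}_{(z_1+1)s_1}\times\cdots\times\mathbb{Z}_{(z_r+1)s_r}$, $H=\{h\in E : h_i=0 \text{ if } z_i=0,\ h_i\in\{0,s_i\}\text{ if } z_i=1\}$, $K=\{k\in H: k\text{ has an even number of nonzero coordinates}\}$. For $g\in E$ with reduction $a$ modulo $\mathbf s$ (coordinatewise, viewed in $G$ and in $E$), the expansion is $\phi'(g)=\phi(a)$ if $g\in a+K$ and $-\phi(a)$ otherwise. $R_{\phi'}(g)=\sum_{x\in E}\phi'(x)\phi'(x+g)$. A GOBA$(\mathbf s)$ of type $\mathbf z$ is a map $\phi:G\to\{\pm1\}$ such that (i) $R_{\phi'}(g)\in\{0,\pm2|H|\}$ for all $g\in E\setminus H$, and, if $z_1=1$, also (ii) $|\{g\in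 E\mid R_{\phi'}(g)=0\}|=|E|/2$. Relative quasi-difference set: let $\mathcal{E}$ be a group of order $8t+4$ and $Z\cong\mathbb{Z}_2$ a normal subgroup. A relative $(4t+2,2,4t+2,2t+1)$-quasi-difference set in $\mathcal E$ with forbidden subgroup $Z$ is a transversal $R$ for $Z$ in $\mathcal E$ containing a subset $S\subset R\setminus\{1\}$ of size $0$ or $2t+1$ such that for all $x\in\mathcal E\setminus Z$, $|R\cap xR|=2t+1$ if $x\in SZ$ and $|R\cap xR|\in\{2t,2t+2\}$ otherwise (here written additively in $E/K$). It is extremal if $S=\emptyset$. *)

(* Defs.v *)
From HB Require Import structures.
From mathcomp Require Import all_boot all_order all_fingroup all_algebra.

Set Implicit Arguments.
Unset Strict Implicit.
Unset Printing Implicit Defensive.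

Import GroupScope GRing.Theory Num.Theory.

(* The product of the Z_(s i), with the componentwise group law, which the
   library writes multiplicatively: [x * y] is the sum x + y, and [1] is the
   neutral element 0.  On each factor 'Z_n, [0%R] and [1%g] are
   the same element.  'Z_n is the ring of integers mod n only for n > 1. *)
Notation Zprod s := {dffun forall i, 'Z_(s i)}.

Section Arrays.

Variables (r : nat) (s : 'I_r.+1 -> nat) (z : 'I_r.+1 -> bool).

Definition exp_dims (i : 'I_r.+1) : nat := ((z i).+1 * s i)%N.

Definition Hset : {set Zprod exp_dims} :=
  [set h : Zprod exp_dims |
    [forall i, if z i then (nat_of_ord (h i) == 0) || (nat_of_ord (h i) == s i)
               else nat_of_ord (h i) == 0]].

Definition Kset : {set Zprod exp_dims} :=
  [set k in Hset | ~~ odd #|[set i | nat_of_ord (k i) != 0]|].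

Lemma HsetP (h : Zprod exp_dims) :
  reflect (forall i, nat_of_ord (h i) = 0 \/ z i /\ nat_of_ord (h i) = s i)
          (h \in Hset).
Proof.
rewrite inE; apply: (iffP forallP) => hh i; have := hh i; case: (z i).
- by case/orP=> /eqP; [left | right].
- by move/eqP; left.
- by case=> [->|[_ ->]]; rewrite eqxx ?orbT.
- by case=> [->|[]].
Qed.

Lemma Hset_mul_coord (h k : Zprod exp_dims) i : h \in Hset -> k \in Hset ->
  (nat_of_ord ((h * k) i) = 0 \/ z i /\ nat_of_ord ((h * k) i) = s i) /\
  (nat_of_ord ((h * k) i) != 0) =
    (nat_of_ord (h i) != 0) (+) (nat_of_ord (k i) != 0).
Proof.
move=> /HsetP/(_ i) Hh /HsetP/(_ i) Hk.
have -> : nat_of_ord ((h * k) i) = ((h i + k i) %% (Zp_trunc (exp_dims i)).+2)%N.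
  by rewrite ffunE.
case: Hh Hk => [h0|[zi hs]] [k0|[zi' ks]].
- by rewrite h0 k0 mod0n; split; [left|].
- rewrite h0 modn_small ?ltn_ord //; split=> //; by right.
- rewrite k0 addn0 modn_small ?ltn_ord // addbF; split=> //; by right.
rewrite hs ks; have [s0|sp] := posnP (s i); first by rewrite s0 mod0n; split; [left|].
have -> : (Zp_trunc (exp_dims i)).+2 = (s i + s i)%N.
  by rewrite Zp_cast /exp_dims zi mul2n -addnn // -addn1 leq_add.
by rewrite modnn addbb; split; [left|].
Qed.

Lemma Hset_group_set : group_set Hset.
Proof.
apply/group_setP; split=> [|h k hH kH].
  by apply/HsetP => i; left; rewrite ffunE.
by apply/HsetP => i; case: (Hset_mul_coord i hH kH).
Qed.
Canonical Hgrp := Group Hset_group_set.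

Lemma Kset_group_set : group_set Kset.
Proof.
have supp (h : Zprod exp_dims) : odd #|[set i | nat_of_ord (h i) != 0]| =
    \big[addb/false]_i (nat_of_ord (h i) != 0).
  rewrite -sum1_card (eq_bigl (fun i => nat_of_ord (h i) != 0)); last first.
    by move=> i; rewrite inE.
  rewrite (big_morph odd oddD (erefl : odd 0 = false)) big_mkcond.
  by apply: eq_bigr => i _; case: (_ != _).
have KE (h : Zprod exp_dims) : (h \in Kset) = (h \in Hset) &&
    ~~ odd #|[set i | nat_of_ord (h i) != 0]| by rewrite /Kset in_set.
apply/group_setP; split=> [|h k].
  rewrite KE group1 (_ : [set _ | _] = set0) ?cards0 //.
  by apply/setP=> i; rewrite !inE ffunE.
rewrite !KE !supp => /andP[hH hp] /andP[kH kp]; rewrite groupM //=.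
under eq_bigr => i _ do rewrite (proj2 (Hset_mul_coord i hH kH)).
by rewrite big_split /= (negbTE hp) (negbTE kp).
Qed.
Canonical Kgrp := Group Kset_group_set.

Definition red_mod (g : Zprod exp_dims) : Zprod s :=
  [ffun i => inZp (nat_of_ord (g i))].

(* [a] viewed in E through its least nonnegative coordinates. *)
Definition lift_rep (a : Zprod s) : Zprod exp_dims :=
  [ffun i => inZp (nat_of_ord (a i))].

Definition expansion (phi : Zprod s -> int) (g : Zprod exp_dims) : int :=
  let a := red_mod g in
  if g \in lift_rep a *: Kset then phi a else (- phi a)%R.

Definition autocorr (f : Zprod exp_dims -> int) (g : Zprod exp_dims) : int :=
  (\sum_(x : Zprod exp_dims) f x * f (x * g)%g)%R.

Definition is_binary (phi : Zprod s -> int) : Prop :=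
  forall a, phi a = 1%R \/ phi a = (-1)%R.

Definition is_GOBA (phi : Zprod s -> int) : Prop :=
  [/\ is_binary phi,
      forall g, g \notin Hset ->
        autocorr (expansion phi) g
          \in [:: 0; 2 * (#|Hset|%:Z); - (2 * (#|Hset|%:Z))]%R
    & z ord0 ->
        (2 * #|[set g | autocorr (expansion phi) g == 0%R]|
         = #|[set: Zprod exp_dims]|)%N ].

Definition EmodK : {group coset_of Kset} :=
  [group of [set: Zprod exp_dims] / Kset].

Definition HmodK : {group coset_of Kset} := [group of Hset / Kset].

Definition neg_cosets (phi : Zprod s -> int) : {set coset_of Kset} :=
  [set coset Kset g | g : Zprod exp_dims & expansion phi g == (-1)%R].

End Arrays.

Section QuasiDifferenceSets.

Variables (gT : finGroupType) (t : nat) (E Z : {group gT}).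

Definition is_rqds_with (R S : {set gT}) : Prop :=
  [/\ #|E| = (8 * t + 4)%N, Z <| E & Z \isog [set: 'Z_2]] /\
  [/\ is_transversal R (rcosets Z E) E,
      S \subset R :\ 1,
      #|S| = 0 \/ #|S| = (2 * t + 1)%N
    & forall x, x \in E :\: Z ->
        if x \in S * Z then #|R :&: (x *: R)| = (2 * t + 1)%N
        else #|R :&: (x *: R)| = (2 * t)%N \/ #|R :&: (x *: R)| = (2 * t + 2)%N].

Definition is_rqds (R : {set gT}) : Prop :=
  exists S : {set gT}, is_rqds_with R S.

Definition is_extremal_rqds (R : {set gT}) : Prop := is_rqds_with R set0.

End QuasiDifferenceSets.

(* Main.v *)
(** Write [exp_neg] for the set where the expansion [f] of [phi] is [-1]; it is
    [K]-invariant, and translation by an element of [H \ K] complements it, so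
    its image [D] in [E / K] is a transversal of [H / K].  Counting sign
    patterns gives [R_f(g) = |K| (4 |D \cap gD| - (8 t + 4))], which matches the
    values [0, 2|H|, -2|H|] with the overlaps [2 t + 1, 2 t + 2, 2 t].

    The location of the zeros is forced by parity.  Summing over the transversal
    [G] of [H] in [E], [R_f(g) = |H| (4 t + 2 - 2 n)], where [n] is the number
    of sign disagreements.  The parity of [n] is the image of [g] under the
    transfer [E -> H], that is under [g |-> (4 t + 2) g], followed by the
    character of [H] with kernel [K]; it is odd iff [z_1 = 1] and [g_1] is odd.
    Hence for an array with admissible autocorrelations there are no zeros when
    [z_1 = 0], and the zeros are exactly the [g] with [g_1] odd when [z_1 = 1]. *)
Require Import Defs.
From mathcomp Require Import all_boot all_order all_fingroup all_algebra.
From mathcomp Require Import cyclic zify.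

Set Implicit Arguments.
Unset Strict Implicit.
Unset Printing Implicit Defensive.

Import GRing.Theory Num.Theory.

(** * Sign patterns on an abelian group twisted by a character of [H] with kernel [K] *)

Section SignedCosets.

Local Open Scope group_scope.

Variables (eT : finGroupType) (H K : {group eT}) (b : eT -> bool) (h0 : eT).
Hypothesis abE : forall x y : eT, x * y = y * x.
Hypothesis sKH : K \subset H.
(** Applied to a product of two elements of [H], this forces [h |-> (h \notin K)] to be a
    homomorphism from [H] to the two-element group with kernel [K]. *)
Hypothesis bM : forall x h, h \in H -> b (x * h) = b x (+) (h \notin K).
Hypotheses (h0H : h0 \in H) (h0K : h0 \notin K).

Let P := [set x | b x].
Let D := coset K @: P.

Lemma norm_all (A : {set eT}) (L : {group eT}) : A \subset 'N(L).
Proof.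
apply/subsetP=> x _; rewrite inE; apply/subsetP=> _ /imsetP[y yL ->].
by rewrite conjgE abE mulgK.
Qed.

Lemma in_norm_all (x : eT) (L : {group eT}) : x \in 'N(L).
Proof. exact: (subsetP (norm_all [set: eT] L)). Qed.

Lemma cosetMT (x y : eT) : coset K (x * y) = coset K x * coset K y.
Proof. by rewrite morphM ?in_norm_all. Qed.

Lemma cosetVT (x : eT) : coset K x^-1 = (coset K x)^-1.
Proof. by rewrite morphV ?in_norm_all. Qed.

Lemma eq_cosetT (x y : eT) : (coset K y == coset K x) = (y \in x *: K).
Proof.
have -> : x *: K = K :* x by apply/esym/norm_rlcoset/in_norm_all.
apply/eqP/idP => [e|/rcosetP[k kK ->]]; last first.
  by rewrite cosetMT (coset_id kK) mul1g.
by apply/rcoset_kercosetP => //; exact: in_norm_all.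
Qed.

(** A [K]-invariant set contains the whole fibre of [coset K] over each point of its image, and
    every fibre is a coset of [K]. *)
Lemma card_coset_imset (A : {set eT}) :
  (forall x k, k \in K -> x \in A -> x * k \in A) ->
  (#|coset K @: A| * #|K| = #|A|)%N.
Proof.
move=> AK; rewrite -[RHS]sum1_card.
rewrite (partition_big (coset K) (mem (coset K @: A))).
  rewrite -sum_nat_const; apply: eq_bigr => _ /imsetP[x xA ->].
  rewrite sum1_card -(card_lcoset K x); apply: eq_card => y.
  rewrite -eq_cosetT unfold_in /=; case: (boolP (_ == _)) => e; last first.
    by rewrite andbF.
  rewrite andbT; apply/esym; move: e; rewrite eq_cosetT => /lcosetP[k kK ->].
  exact: AK.
by move=> x xA; apply: imset_f.
Qed.

Lemma mem_coset_imset (A : {set eT}) x :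
  (forall x k, k \in K -> x \in A -> x * k \in A) ->
  (coset K x \in coset K @: A) = (x \in A).
Proof.
move=> AK; apply/imsetP/idP => [[y yA /eqP]|xA]; last by exists x.
by rewrite eq_cosetT => /lcosetP[k kK ->]; apply: AK.
Qed.

Lemma sign_mulK x k : k \in K -> b (x * k) = b x.
Proof. by move=> kK; rewrite bM ?(subsetP sKH) // kK addbF. Qed.

Lemma neg_mulK x k : k \in K -> x \in P -> x * k \in P.
Proof. by move=> kK; rewrite !inE sign_mulK. Qed.

Lemma mem_neg_coset x : (coset K x \in D) = b x.
Proof. by rewrite mem_coset_imset ?inE //; apply: neg_mulK. Qed.

(** Translation by [h0] preserves [A] and flips [b], so it exchanges the two halves of [A]. *)
Lemma card_neg_half (A : {set eT}) :
  (forall x, (x * h0 \in A) = (x \in A)) ->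
  #|A| = (2 * #|[set x in A | b x]|)%N.
Proof.
move=> Ah; rewrite -(cardsID P A) mul2n -addnn; congr (_ + _)%N.
  by apply: eq_card => x; rewrite !inE.
rewrite -(card_preimset _ (mulIg h0)); apply: eq_card => x.
by rewrite !inE Ah bM // h0K addbT negbK andbC.
Qed.

Lemma card_neg : #|eT| = (2 * #|P|)%N.
Proof.
rewrite -cardsT (card_neg_half (A := setT)) => [|x]; last by rewrite !inE.
by congr (_ * _)%N; apply: eq_card => x; rewrite !inE.
Qed.

Lemma card_forbidden : #|H| = (2 * #|K|)%N.
Proof.
have hb x : x \in H -> (b x == b 1) = (x \in K).
  by move=> xH; rewrite -[x in b x]mul1g bM //; case: (b 1); case: (x \in K).
rewrite -(cardsID K H) (setIidPr sKH) mul2n -addnn; congr (_ + _)%N.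
(* The complement of [K] in [H] is the coset of [h0]: on [H], [b] agrees with [b 1] exactly on [K],
   and [h0] flips it. *)
rewrite -(card_lcoset K h0); apply: eq_card => x.
rewrite mem_lcoset !inE andbC; case: (boolP (x \in H)) => xH /=.
  have yH : h0^-1 * x \in H by rewrite groupM ?groupV.
  rewrite -(hb _ yH) -(hb _ xH) abE bM ?groupV // h0K.
  by case: (b x); case: (b 1).
apply/esym/negP => /(subsetP sKH) yH.
by move: xH; rewrite -(mulKVg h0 x) groupM.
Qed.

Lemma card_forbidden_quotient : #|H / K| = 2.
Proof.
by rewrite card_quotient ?norm_all // -divgS // card_forbidden mulnK.
Qed.

Lemma forbidden_isog : H / K \isog [set: 'Z_2].
Proof.
have cZ : cyclic [set: 'Z_2] by rewrite prime_cyclic ?cardsT ?card_ord.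
rewrite isog_sym isog_cyclic_card // cardsT card_ord card_forbidden_quotient.
by rewrite prime_cyclic ?card_forbidden_quotient.
Qed.

Lemma coset_surj (X : coset_of K) : exists x, X = coset K x.
Proof. by case: (cosetP X) => x _ ->; exists x. Qed.

Lemma mem_quotientT (A : {group eT}) x : K \subset A ->
  (coset K x \in A / K) = (x \in A).
Proof.
move=> sKA; rewrite /quotient morphimEsub ?norm_all // mem_coset_imset //.
by move=> y k /(subsetP sKA) kA yA; apply: groupM.
Qed.

(** Each coset of [H] splits into two cosets of [K], exchanged by [h0]; [b] is constant on each and
    differs between them, so exactly one lies in [D]. *)
Lemma neg_coset_transversal :
  is_transversal D (rcosets (H / K) ([set: eT] / K)) ([set: eT] / K).
Proof.
apply/and3P; split.
- by apply: rcosets_partition; apply: quotientS; apply: subsetT.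
- apply/subsetP=> X _; have [x ->] := coset_surj X.
  by rewrite mem_quotient ?inE.
apply/forall_inP=> _ /rcosetsP[X _ ->]; have [x ->] := coset_surj X.
(* The representative of the coset of [x] modulo [H], moved by [h0] if necessary so that [b]
   holds. *)
pose y := if b x then x else x * h0.
have by_ : b y by rewrite /y; case: ifP => // bx; rewrite bM // bx h0K.
have yx : y * x^-1 \in H.
  by rewrite /y; case: ifP => _; rewrite ?mulgV // abE mulKg.
apply/eqP/(@eq_card1 _ (coset K y)) => Z; have [w ->] := coset_surj Z.
rewrite inE mem_neg_coset mem_rcoset -cosetVT -cosetMT mem_quotientT // !inE.
rewrite eq_cosetT mem_lcoset.
have wy : (w * x^-1 \in H) = (y^-1 * w \in H).
  by rewrite -(groupMr _ (groupVr yx)) invMg invgK mulgA mulgKV abE.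
rewrite wy; case: (boolP (y^-1 * w \in H)) => [yw|]; last first.
  by move=> nH; rewrite andbF; apply/esym/negP => /(subsetP sKH); apply/negP.
by rewrite andbT -[w in b w](mulKVg y) bM // by_ /= negbK.
Qed.

Lemma card_overlap g :
  (#|D :&: (coset K g *: D)| * #|K| = #|[set x | b x && b (x * g)]|)%N.
Proof.
(* Shifting by the inverse of [g] turns the condition into [b (x * g^-1) && b x], which is
   membership of the coset of [x] in both [D] and its translate. *)
rewrite -(card_preimset [set x | b x && b (x * g)] (mulIg g^-1)).
set A := _ @^-1: _.
have AE x : (x \in A) = b (x * g^-1) && b x by rewrite !inE mulgKV.
have AK x k : k \in K -> x \in A -> x * k \in A.
  by move=> kK; rewrite !AE -mulgA (abE k) mulgA !(sign_mulK _ kK).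
rewrite -(card_coset_imset AK); congr (_ * _)%N; apply: eq_card => X.
have [x ->] := coset_surj X.
rewrite mem_coset_imset // AE inE mem_lcoset -cosetVT -cosetMT !mem_neg_coset.
by rewrite andbC abE.
Qed.

Lemma autocorr_card g :
  (\sum_x (-1) ^+ b x * (-1) ^+ b (x * g)%g + #|eT|%:Z =
   4 * #|[set x | b x && b (x * g)%g]|%:Z :> int)%R.
Proof.
have cE (A : {set eT}) : (#|A|%:Z = \sum_x (x \in A)%:Z :> int)%R.
  rewrite -sum1_card big_mkcond -natz raddf_sum; apply: eq_bigr => x _ /=.
  by rewrite natz; case: (x \in A).
have cP : (#|P|%:Z = \sum_x (b x)%:Z :> int)%R.
  by rewrite cE; apply: eq_bigr => x _; rewrite inE.
have cPg : (#|P|%:Z = \sum_x (b (x * g)%g)%:Z :> int)%R.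
  by rewrite cP (reindex_inj (mulIg g)).
(* As [b] holds on half of the group, both sums of [b] equal half of [#|eT|]. The claim becomes the
   termwise identity (-1)^u (-1)^v = 1 - 2u - 2v + 4uv for bits u, v. *)
have -> : (#|eT|%:Z =
    2 * \sum_x (b x)%:Z + 2 * \sum_x (b (x * g)%g)%:Z - #|eT|%:Z :> int)%R.
  by rewrite -cP -cPg card_neg; clear; lia.
rewrite -{1}cardsT (cE setT) (cE [set x | _]) !mulr_sumr -sumrN -!big_split /=.
apply: eq_bigr => x _; rewrite !inE.
by case: (b x); case: (b (x * g)%g).
Qed.

(** * The part of [D] lying over a union of cosets of [H] *)

Variable A : {set eT}.
Hypothesis AH : forall x h, h \in H -> (x * h \in A) = (x \in A).

(** With [A] the zero set of the autocorrelation, this is the subset demanded by a quasi-difference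
    set: [D] meets each coset of [H] once, so [S] has one point over each coset in [A]. *)
Let S := coset K @: [set x in A | b x].

Let SK x k :
  k \in K -> x \in [set x in A | b x] -> x * k \in [set x in A | b x].
Proof. by move=> kK; rewrite !inE sign_mulK // AH // (subsetP sKH). Qed.

Lemma card_neg_part : (2 * (#|S| * #|K|) = #|A|)%N.
Proof. by rewrite (card_coset_imset SK) -card_neg_half // => x; rewrite AH. Qed.

Lemma neg_part_sub : 1 \notin A -> S \subset D :\ 1.
Proof.
move=> A1; apply/subsetP=> X; have [x ->] := coset_surj X.
rewrite (mem_coset_imset _ SK) !inE mem_neg_coset => /andP[xA ->]; rewrite andbT.
apply: contra A1 => /eqP/coset_idr xK.
by rewrite -[1](mulgV x) AH // groupV (subsetP sKH) // xK ?in_norm_all.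
Qed.

Lemma mem_neg_part_forbidden x : (coset K x \in S * (H / K)) = (x \in A).
Proof.
apply/mulsgP/idP => [[X Y]|xA].
  have [y ->] := coset_surj X; have [h ->] := coset_surj Y.
  rewrite (mem_coset_imset _ SK) mem_quotientT // !inE => /andP[yA _] hH /eqP.
  rewrite -cosetMT eq_cosetT => /lcosetP[k kK ->].
  by rewrite -mulgA AH // groupM // (subsetP sKH).
(* The correction by [h] moves [x] to the point of its [H]-coset where [b] holds; its inverse
   supplies the factor in [H / K]. *)
pose h := if b x then 1 else h0.
have hH : h \in H by rewrite /h; case: ifP.
exists (coset K (x * h)) (coset K h^-1); last by rewrite -cosetMT mulgK.
  rewrite (mem_coset_imset _ SK) !inE AH // xA /= /h.
  by case: ifP => bx; rewrite ?mulg1 // bM // bx h0K.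
by rewrite mem_quotientT // groupV.
Qed.

End SignedCosets.

Lemma big_addb_odd (I : finType) (u : pred I) :
  \big[addb/false]_i u i = odd #|[set i | u i]|.
Proof.
rewrite -sum1_card (big_morph odd oddD (erefl : odd 0 = false)) [RHS]big_mkcond.
by apply: eq_bigr => i _; rewrite inE; case: (u i).
Qed.

(** * Coordinates in E and G, and reduction modulo s *)

Section ArrayExpansion.

Local Open Scope group_scope.

Lemma Zprod_valM n (d : 'I_n -> nat) (x y : Zprod d) i : 1 < d i ->
  nat_of_ord ((x * y) i) = ((x i + y i) %% d i)%N.
Proof. by move=> d1; rewrite ffunE /=; congr (_ %% _)%N; apply: Zp_cast. Qed.

Lemma Zprod_mulgC n (d : 'I_n -> nat) (x y : Zprod d) : x * y = y * x.
Proof. by apply/ffunP=> i; rewrite !ffunE; apply: Zp_mulgC. Qed.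

Lemma Zprod_eqP n (d : 'I_n -> nat) (x y : Zprod d) :
  (forall i, nat_of_ord (x i) = y i) -> x = y.
Proof. by move=> e; apply/ffunP=> i; apply/val_inj/e. Qed.

Lemma Zprod_lt n (d : 'I_n -> nat) (x : Zprod d) i : 1 < d i -> x i < d i.
Proof. by move=> d1; apply: leq_trans (ltn_ord _) _; rewrite Zp_cast. Qed.

Lemma card_Zprod n (d : 'I_n -> nat) : (forall i, 1 < d i) ->
  #|Zprod d| = (\prod_i d i)%N.
Proof.
move=> d1; rewrite card_dep_ffun foldrE big_image /=.
by apply: eq_bigr => i _; rewrite card_ord Zp_cast.
Qed.

Lemma Zprod_prod n (d : 'I_n -> nat) (I : Type) (l : seq I)
    (F : I -> Zprod d) i :
  (\prod_(a <- l) F a) i = (\sum_(a <- l) F a i)%R.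
Proof.
by apply: (big_morph (fun x : Zprod d => x i)) => [x y|]; rewrite ffunE.
Qed.

Variables (r : nat) (s : 'I_r.+1 -> nat) (z : 'I_r.+1 -> bool).
Hypothesis s1 : forall i, 1 < s i.

Local Notation ed := (exp_dims s z).
Local Notation E := (Zprod (exp_dims s z)).
Local Notation G := (Zprod s).
Local Notation H := (Hset s z).
Local Notation K := (Kset s z).
Local Notation red := (@red_mod r s z).
Local Notation lift := (@lift_rep r s z).

Lemma exp_gt1 i : 1 < ed i.
Proof. rewrite /exp_dims; have := s1 i; case: (z i); lia. Qed.

Lemma val_red (g : E) i : nat_of_ord (red g i) = (g i %% s i)%N.
Proof. by rewrite ffunE /= (Zp_cast (s1 i)). Qed.

Lemma val_lift (a : G) i : nat_of_ord (lift a i) = a i.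
Proof.
rewrite ffunE /= (Zp_cast (exp_gt1 i)) modn_small //.
apply: (leq_trans (Zprod_lt a (s1 i))).
by rewrite /exp_dims leq_pmull.
Qed.

Lemma red_modM : {morph red : x y / x * y}.
Proof.
move=> x y; apply: Zprod_eqP => i.
rewrite Zprod_valM // !val_red Zprod_valM ?exp_gt1 // modnDm modn_dvdm //.
by rewrite /exp_dims dvdn_mull.
Qed.

Lemma red_mod1 : red 1 = 1.
Proof. by apply: (mulgI (red 1)); rewrite -red_modM !mulg1. Qed.

Lemma red_modV x : red x^-1 = (red x)^-1.
Proof. by apply: (mulgI (red x)); rewrite -red_modM !mulgV red_mod1. Qed.

Lemma lift_repK : cancel lift red.
Proof.
move=> a; apply: Zprod_eqP => i.
by rewrite val_red val_lift modn_small // Zprod_lt.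
Qed.

(** A multiple of s_i below (z_i + 1) s_i is 0, or s_i when z_i = 1. Thus [Hset] is the kernel of
    reduction, and the lifts of G form a transversal for it. *)
Lemma mem_Hset x : (x \in H) = (red x == 1).
Proof.
apply/HsetP/eqP => [xH|x1 i].
  apply: Zprod_eqP => i; rewrite val_red ffunE /=.
  by case: (xH i) => [->|[_ ->]]; rewrite ?mod0n ?modnn.
have xi : (x i %% s i)%N = 0 by rewrite -val_red x1 ffunE.
have := Zprod_lt x (exp_gt1 i); move: (nat_of_ord (x i)) xi => v xi.
move: (divn_eq v (s i)); rewrite xi addn0 /exp_dims => ->.
rewrite ltn_pmul2r; last by rewrite ltnW.
by case: (z i); case: (_ %/ _)%N => [|[|q]] //=; rewrite ?mul1n; auto.
Qed.

Lemma lift_red_H g : (lift (red g))^-1 * g \in H.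
Proof. by rewrite mem_Hset red_modM red_modV lift_repK mulVg. Qed.

(** * The character of H with kernel K, and sums over cosets of H *)

Definition supp_parity (h : E) : bool :=
  \big[addb/false]_i (nat_of_ord (h i) != 0%N).

Lemma supp_parity1 : supp_parity 1 = false.
Proof. by rewrite /supp_parity big1 // => i _; rewrite ffunE. Qed.

Lemma supp_parityM h k : h \in H -> k \in H ->
  supp_parity (h * k) = supp_parity h (+) supp_parity k.
Proof.
move=> hH kH; rewrite /supp_parity -big_split.
by apply: eq_bigr => i _; rewrite (proj2 (Hset_mul_coord i hH kH)).
Qed.

Lemma mem_Kset h : h \in H -> (h \in K) = ~~ supp_parity h.
Proof. by move=> hH; rewrite /Kset in_set hH /supp_parity big_addb_odd. Qed.

Lemma KsubH : K \subset H.
Proof. by apply/subsetP=> x; rewrite [x \in K]in_set => /andP[]. Qed.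

(** The witness has s_i as its only nonzero coordinate, at an index where z_i = 1, so its support
    has odd size. *)
Lemma ex_odd_H : (exists i, z i) -> exists2 h, h \in H & h \notin K.
Proof.
case=> i0 zi0.
pose h : E := [ffun i => inZp (if i == i0 then s i else 0%N)].
have hv i : nat_of_ord (h i) = if i == i0 then s i else 0%N.
  rewrite ffunE /= Zp_cast ?exp_gt1 // modn_small //.
  case: eqP => [->|_]; last by rewrite ltnW ?exp_gt1.
  rewrite /exp_dims zi0; have := s1 i0; lia.
have hH : h \in H.
  by apply/HsetP=> i; rewrite hv; case: eqP => [->|_]; [right|left].
exists h => //; rewrite mem_Kset // negbK /supp_parity (bigD1 i0) //= big1.
  by rewrite hv eqxx addbF; have := s1 i0; case: (s i0).
by move=> i /negbTE ni; rewrite hv ni.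
Qed.

Lemma sum_H_invariant (V : nmodType) (F : E -> V) :
  (forall x h, h \in H -> F (x * h) = F x) ->
  (\sum_x F x = (\sum_a F (lift a)) *+ #|H|)%R.
Proof.
move=> FH; rewrite (partition_big red predT) //= -sumrMnl; apply: eq_bigr => a _.
rewrite (reindex_inj (mulgI (lift a))) /=.
rewrite (eq_bigl (fun h => h \in H)) => [|h]; last first.
  by rewrite red_modM lift_repK mem_Hset -[RHS](inj_eq (mulgI a)) mulg1.
by rewrite -sumr_const; apply: eq_bigr => h hH; rewrite FH.
Qed.

Lemma card_E : #|E| = (#|G| * #|H|)%N.
Proof.
have := sum_H_invariant (F := fun _ => 1%N) (fun _ _ _ => erefl).
rewrite -mulr_natr natn => e.
by rewrite -[LHS]sum1_card -[#|G|]sum1_card; apply: e.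
Qed.

(** * The sign of the expansion and its autocorrelation *)

Variable phi : G -> int.
Hypothesis phi2 : is_binary phi.

(** Writing g as the lift of its reduction plus an element of H, the sign is that of [phi] twisted
    by the character at the H-part. *)
Definition exp_neg (g : E) : bool :=
  (phi (red g) == -1)%R (+) supp_parity ((lift (red g))^-1 * g).

Lemma expansionE g : expansion phi g = ((-1) ^+ exp_neg g)%R.
Proof.
rewrite /expansion mem_lcoset mem_Kset ?lift_red_H // /exp_neg.
by case: (phi2 (red g)) => ->; case: (supp_parity _).
Qed.

Lemma exp_negM (x h : E) : h \in H ->
  exp_neg (x * h) = exp_neg x (+) (h \notin K).
Proof.
move=> hH; have : red h = 1 by apply/eqP; rewrite -mem_Hset.
rewrite /exp_neg red_modM => ->; rewrite mulg1 mulgA supp_parityM ?lift_red_H //.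
by rewrite mem_Kset // negbK addbA.
Qed.

Lemma exp_neg_lift a : exp_neg (lift a) = (phi a == -1)%R.
Proof. by rewrite /exp_neg lift_repK mulVg supp_parity1 addbF. Qed.

Definition slice_disagree (g : E) : {set G} :=
  [set a | exp_neg (lift a) (+) exp_neg (lift a * g)].

(** Moving x by an element of H changes both factors of a summand by the same sign, so the sum is
    [#|H|] times its restriction to the lifts. *)
Lemma autocorr_slice g :
  autocorr (expansion phi) g =
  ((#|G|%:Z - 2 * #|slice_disagree g|%:Z) * #|H|%:Z)%R.
Proof.
rewrite /autocorr sum_H_invariant => [|x h hH]; last first.
  rewrite -mulgA (Zprod_mulgC h) mulgA !expansionE !(exp_negM _ hH).
  by case: (_ \notin _); case: (exp_neg x); case: (exp_neg (x * g)).
rewrite -[LHS]mulr_natr natz; congr (_ * _)%R.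
rewrite -cardsT -!sum1_card !(big_morph Posz PoszD erefl) mulr_sumr /=.
rewrite [X in (_ - X)%R]big_mkcond [X in (X - _)%R]big_mkcond -sumrB.
apply: eq_bigr => a _; rewrite !inE !expansionE -signr_addb.
by case: (_ (+) _).
Qed.

(* The [phi]-values cancel because [a |-> a * red g] permutes [G]; what is left
   is the parity of the product of the [H]-parts of [lift a * g], in which the
   representatives cancel for the same reason, leaving [g ^+ #|G|]. *)
Lemma odd_slice_disagree g :
  odd #|slice_disagree g| =
  \big[addb/false]_i ((g i * #|G|) %% ed i != 0)%N.
Proof.
pose h (a : G) : E := (lift (a * red g))^-1 * (lift a * g).
have hH a : h a \in H.
  by have := lift_red_H (lift a * g); rewrite red_modM lift_repK.
have [_ hprod] : \prod_a h a \in H /\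
    \big[addb/false]_a supp_parity (h a) = supp_parity (\prod_a h a).
  pose Q p q := q \in H /\ p = supp_parity q.
  apply: (big_rec2 Q) => [|a p q _ [qH ->]].
    by rewrite /Q group1 supp_parity1.
  by split; [exact: (groupM (hH a) qH) | rewrite (supp_parityM (hH a) qH)].
rewrite -big_addb_odd.
under eq_bigr => a _.
  rewrite exp_neg_lift /exp_neg red_modM lift_repK addbA -/(h a); over.
rewrite !big_split /= [X in X (+) _ (+) _](reindex_inj (mulIg (red g))) /=.
rewrite addbb /= hprod; apply: eq_bigr => i _; congr (_ != _).
rewrite Zprod_prod.
have -> : (\sum_a h a i)%R = (g i *+ #|G|)%R.
  have -> : (\sum_a h a i = \sum_a (- lift (a * red g)%g i + lift a i + g i))%R.
    by apply: eq_bigr => a _; rewrite !ffunE -addrA.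
  rewrite !big_split /= sumrN sumr_const.
  rewrite [X in (_ + X + _)%R](reindex_inj (mulIg (red g))) /=.
  by rewrite addNr add0r.
by rewrite Zp_mulrn /=; congr (_ %% _)%N; apply/Zp_cast/exp_gt1.
Qed.

Lemma autocorrMH g h : h \in H ->
  autocorr (expansion phi) (g * h) =
  ((-1) ^+ (h \notin K) * autocorr (expansion phi) g)%R.
Proof.
move=> hH; rewrite /autocorr mulr_sumr; apply: eq_bigr => x _.
by rewrite !expansionE mulgA (exp_negM _ hH) signr_addb mulrA mulrC.
Qed.

(** * Parity of the disagreements and location of the zeros *)

Variable t : nat.
Hypothesis prod_s : (\prod_i s i = 4 * t + 2)%N.
Hypotheses (s0_even : (2 %| s ord0)%N) (s0_half_odd : odd (s ord0 %/ 2)).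

Lemma card_G : #|G| = (4 * t + 2)%N.
Proof. by rewrite card_Zprod. Qed.

(** For i other than 0, the factor s_0 s_i of [#|G|] is divisible by (z_i + 1) s_i because s_0 is
    even. At 0, [#|G|] is s_0 times an odd m, so for z_0 = 1 the product g_0 s_0 m vanishes modulo 2
    s_0 iff g_0 is even. *)
Lemma supp_parity_transfer (g : E) :
  \big[addb/false]_i ((g i * #|G|) %% ed i != 0)%N = z ord0 && odd (g ord0).
Proof.
have prod0 : (\prod_i s i = s ord0 * \prod_(i | i != ord0) s i)%N.
  by rewrite (bigD1 ord0).
rewrite card_Zprod // (bigD1 ord0) //= [X in _ (+) X]big1 => [|i i0].
  rewrite addbF prod0 /exp_dims; set m := (\prod_(i | _) _)%N.
  have um : (s ord0 %/ 2 * m = 2 * t + 1)%N.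
    have := divnK s0_even; have := prod0; rewrite prod_s -/m; nia.
  have om : odd m.
    by have := congr1 odd um; rewrite oddM oddD mul2n odd_double /= => /andP[].
  move: (nat_of_ord (g ord0)) => v.
  rewrite mulnCA -/(dvdn _ _); case: (z ord0); last by rewrite mul1n dvdn_mulr.
  rewrite (mulnC 2) dvdn_pmul2l; last by rewrite ltnW.
  by rewrite dvdn2 oddM om andbT negbK.
apply/negP/negP; rewrite -/(dvdn _ _) dvdn_mull // prod0 (bigD1 i) //=.
rewrite mulnA dvdn_mulr //.
by rewrite /exp_dims; case: (z i); [rewrite dvdn_mul | rewrite mul1n dvdn_mull].
Qed.

Lemma odd_slice_disagreeE (g : E) :
  odd #|slice_disagree g| = z ord0 && odd (g ord0).
Proof. by rewrite odd_slice_disagree supp_parity_transfer. Qed.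

Lemma card_Hset_gt0 : (0 < #|H|)%N.
Proof. exact: (cardG_gt0 (Hgrp s z)). Qed.

(** A zero means disagreement on exactly half of G, that is at 2t + 1 points, an odd number. *)
Lemma autocorr0_odd (g : E) :
  autocorr (expansion phi) g = 0%R -> z ord0 && odd (g ord0).
Proof.
rewrite autocorr_slice card_G -odd_slice_disagreeE; have := card_Hset_gt0.
set n := #|slice_disagree g|; set m := #|H| => m0 e.
have -> : n = (2 * t + 1)%N by nia.
by rewrite oddD oddM.
Qed.

(** The values 2|H| and -2|H| correspond to 2t and 2t + 2 disagreements, both even. *)
Lemma autocorr_odd0 (g : E) : autocorr (expansion phi) g
    \in [:: 0; 2 * (#|H|%:Z); - (2 * (#|H|%:Z))]%R ->
  z ord0 && odd (g ord0) -> autocorr (expansion phi) g = 0%R.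
Proof.
rewrite autocorr_slice card_G -odd_slice_disagreeE; have := card_Hset_gt0.
set n := #|slice_disagree g|; set m := #|H| => m0.
rewrite !inE => /or3P[/eqP->|/eqP e|/eqP e] // on.
  have en : n = (2 * t)%N by nia.
  by move: on; rewrite en oddM.
have en : n = (2 * t + 2)%N by nia.
by move: on; rewrite en oddD oddM.
Qed.

Lemma Hset_even (h : E) : h \in H -> odd (h ord0) = false.
Proof.
move=> /HsetP/(_ ord0)[->|[_ ->]] //.
by apply/negbTE; rewrite -dvdn2.
Qed.

Lemma autocorr_H_neq0 (h : E) : h \in H -> autocorr (expansion phi) h != 0%R.
Proof.
by move=> hH; apply/eqP => /autocorr0_odd; rewrite Hset_even // andbF.
Qed.

(** Adding the unit vector at 0 flips the parity of g_0, the modulus 2 s_0 being even. *)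
Lemma card_odd_coord : z ord0 ->
  (2 * #|[set g : E | odd (g ord0)]| = #|E|)%N.
Proof.
move=> z0; pose e : E := [ffun i => inZp (i == ord0)].
have ev : nat_of_ord (e ord0) = 1%N.
  by rewrite ffunE /= Zp_cast ?exp_gt1 // modn_small // exp_gt1.
pose A := [set g : E | odd (g ord0)].
have eA g : (g * e \in A) = (g \notin A).
  rewrite !inE Zprod_valM ?exp_gt1 // ev addn1.
  rewrite -[odd (_ %% _)]negbK -dvdn2 /dvdn modn_dvdm; last first.
    by rewrite /exp_dims z0 dvdn_mulr.
  by rewrite -/(dvdn _ _) dvdn2 /= negbK.
rewrite -/A -(cardsC A) mul2n -addnn; congr (_ + _)%N.
rewrite -(card_preimset A (mulIg e)); apply: eq_card => g.
by rewrite in_setC -eA !inE.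
Qed.

(** * Autocorrelation as overlap in E/K, and the two implications *)

Hypothesis z_neq0 : exists i, z i.

Local Notation D := (neg_cosets z phi).

Lemma neg_cosetsE : D = coset K @: [set x | exp_neg x].
Proof.
have eqb x : (expansion phi x == -1)%R = exp_neg x.
  by rewrite expansionE; case: (exp_neg x).
by apply/setP=> X; apply/imsetP/imsetP => -[x xA ->]; exists x => //;
  move: xA; rewrite !inE eqb.
Qed.

Lemma card_H2K : #|H| = (2 * #|K|)%N.
Proof.
have [h0 h0H h0K] := ex_odd_H z_neq0.
exact: (card_forbidden (H := Hgrp s z) (K := Kgrp s z) (@Zprod_mulgC _ _)
  KsubH exp_negM h0H h0K).
Qed.

Lemma autocorr_overlap (g : E) :
  autocorr (expansion phi) g =
  ((4 * #|D :&: (coset K g *: D)%g|%:Z - (8 * t + 4)%N%:Z) * #|K|%:Z)%R.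
Proof.
have [h0 h0H h0K] := ex_odd_H z_neq0.
have := autocorr_card (H := Hgrp s z) (K := Kgrp s z) exp_negM h0H h0K g.
rewrite card_E card_G card_H2K.
have := card_overlap (H := Hgrp s z) (K := Kgrp s z) (@Zprod_mulgC _ _)
  KsubH exp_negM g.
rewrite -neg_cosetsE => <-.
have -> : autocorr (expansion phi) g =
    (\sum_x (-1) ^+ exp_neg x * (-1) ^+ exp_neg (x * g)%g)%R.
  by apply: eq_bigr => x _; rewrite !expansionE.
move=> /=; set n := #|D :&: _|; set k := #|K|; move=> /(canRL (addrK _)) ->.
by clear; nia.
Qed.

Definition zero_autocorr : {set E} :=
  [set g | autocorr (expansion phi) g == 0%R].

Definition neg_zero_cosets : {set coset_of K} :=
  coset K @: [set x in zero_autocorr | exp_neg x].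

Lemma card_Kset_gt0 : (0 < #|K|)%N.
Proof. exact: (cardG_gt0 (Kgrp s z)). Qed.

Lemma zero_autocorrMH x h : h \in H ->
  (x * h \in zero_autocorr) = (x \in zero_autocorr).
Proof. by move=> hH; rewrite !inE autocorrMH // mulf_eq0 signr_eq0. Qed.

Lemma overlap_cases n : let R := ((4 * n%:Z - (8 * t + 4)%N%:Z) * #|K|%:Z)%R in
  ((R == 0%R) = (n == 2 * t + 1)%N) *
  ((R \in [:: 0; 2 * (#|H|%:Z); - (2 * (#|H|%:Z))]%R) =
   [|| n == 2 * t + 1, n == 2 * t | n == 2 * t + 2]%N).
Proof.
move=> R; rewrite card_H2K !inE {}/R; have := card_Kset_gt0.
set k := #|K|; set R := (_ * _)%R => k0.
have e0 : (R == 0%R) = (n == 2 * t + 1)%N.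
  rewrite /R mulf_eq0 orbC; case: eqP => [|_] /=; first lia.
  by apply/eqP/eqP; lia.
have k0' : (k%:Z != 0)%R by lia.
split=> //; rewrite e0; congr (_ || _); rewrite orbC; congr (_ || _).
  have -> : (- (2 * (2 * k)%N%:Z) = (-4) * k%:Z :> int)%R by lia.
  by rewrite /R (inj_eq (mulIf k0')); apply/eqP/eqP; lia.
have -> : (2 * (2 * k)%N%:Z = 4 * k%:Z :> int)%R by lia.
by rewrite /R (inj_eq (mulIf k0')); apply/eqP/eqP; lia.
Qed.

Lemma card_EmodK : #|EmodK s z| = (8 * t + 4)%N.
Proof.
rewrite /= card_quotient; last first.
  exact: (norm_all (@Zprod_mulgC _ _) _ (Kgrp s z)).
rewrite -divgS ?subsetT //= cardsT card_E card_G card_H2K.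
rewrite mulnA mulnK ?card_Kset_gt0 //; lia.
Qed.

Lemma HmodK_normal : HmodK s z <| EmodK s z.
Proof.
rewrite /normal /= quotientS ?subsetT //=.
apply: quotient_norms; exact: (norm_all (@Zprod_mulgC _ _) _ (Hgrp s z)).
Qed.

Lemma not_mem_HmodK g : coset K g \in EmodK s z :\: HmodK s z -> g \notin H.
Proof.
rewrite inE => /andP[nH _]; apply: contra nH => gH.
exact: (mem_quotient (Kgrp s z) (G := Hgrp s z)).
Qed.

Lemma GOBA_rqds : is_GOBA z phi ->
  is_rqds_with t (EmodK s z) (HmodK s z) D
    (if z ord0 then neg_zero_cosets else set0).
Proof.
case=> _ corr zeros.
have [h0 h0H h0K] := ex_odd_H z_neq0.
have negM := exp_negM.
have abE := @Zprod_mulgC _ (exp_dims s z).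
pose gH := Hgrp s z; pose gK := Kgrp s z.
have sKH : gK \subset gH := KsubH.
have DE := neg_cosetsE.
(* When z_0 = 0 there are no zeros, so both branches are the same set and need no separate treatment
   below. *)
have SE : (if z ord0 then neg_zero_cosets else set0) = neg_zero_cosets.
  case: ifP => // z0; apply/esym/eqP; rewrite -subset0.
  apply/subsetP=> X /imsetP[x]; rewrite !inE => /andP[/eqP x0 _] _.
  by have := autocorr0_odd x0; rewrite z0.
have A1 : 1 \notin zero_autocorr.
  by rewrite inE autocorr_H_neq0.
split; split.
- exact: card_EmodK.
- exact: HmodK_normal.
- exact: (forbidden_isog (H := gH) (K := gK) abE sKH negM h0H h0K).
- rewrite DE.
  exact: (neg_coset_transversal (H := gH) (K := gK) abE sKH negM h0H h0K).
- rewrite SE DE.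
  exact: (neg_part_sub (H := gH) (K := gK) abE sKH negM zero_autocorrMH A1).
- case: ifP => z0; [right|by left; rewrite cards0].
  (* Here 2 |S| |K| is the number of zeros, which condition (ii) makes |E|/2 = (4t + 2) |K|; hence
     |S| = 2t + 1. *)
  have := card_neg_part (H := gH) (K := gK) abE sKH negM h0H h0K zero_autocorrMH.
  rewrite -/neg_zero_cosets => e; have := zeros z0.
  rewrite -/zero_autocorr -e cardsT card_E card_G.
  rewrite card_H2K /= -/neg_zero_cosets.
  have := card_Kset_gt0; set k := #|K|; set n := #|neg_zero_cosets|.
  move=> k0 e2; apply/eqP; rewrite -(eqn_pmul2r k0); apply/eqP; lia.
move=> X XE; have [g Xg] := coset_surj (K := gK) X.
rewrite {}Xg in XE *; rewrite SE.
have := mem_neg_part_forbidden (H := gH) (K := gK) abE sKH negM h0H h0K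
  zero_autocorrMH g.
rewrite -/neg_zero_cosets => ->.
have := corr g (not_mem_HmodK XE).
rewrite [g \in zero_autocorr]inE autocorr_overlap !overlap_cases.
by case: eqP => [-> //|_ /= /orP[] /eqP->]; [left | right].
Qed.

Lemma rqds_GOBA (S : {set coset_of K}) :
  is_rqds_with t (EmodK s z) (HmodK s z) D S -> is_GOBA z phi.
Proof.
case=> _ [_ _ _ ov].
have corr g : g \notin H -> autocorr (expansion phi) g
    \in [:: 0; 2 * (#|H|%:Z); - (2 * (#|H|%:Z))]%R.
  move=> gH; have gX : coset K g \in EmodK s z :\: HmodK s z.
    rewrite inE /= (mem_quotient (Kgrp s z) (G := [set: E]%G)) ?inE // andbT.
    rewrite (mem_quotientT (K := Kgrp s z) (A := Hgrp s z) (@Zprod_mulgC _ _)) //.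
    exact: KsubH.
  rewrite autocorr_overlap !overlap_cases.
  have := ov _ gX; case: ifP => _; first by move=> ->; rewrite eqxx.
  by case=> ->; rewrite eqxx ?orbT.
(* Overlaps give condition (i) whatever [S] is. Condition (ii) then follows by parity: the zeros are
   exactly the g with g_0 odd, and such g lie outside H, where (i) applies. *)
split=> // z0; rewrite cardsT -(card_odd_coord z0); congr (2 * _)%N.
apply: eq_card => g; rewrite !inE; apply/eqP/idP => [|og].
  by move/autocorr0_odd/andP => [].
apply: autocorr_odd0; last by rewrite z0.
by apply: corr; apply/negP => /Hset_even; rewrite og.
Qed.

End ArrayExpansion.

Theorem theorem1 (t r : nat) (s : 'I_r.+1 -> nat) (z : 'I_r.+1 -> bool)
    (phi : Zprod s -> int) :
  0 < t ->
  (forall i, 1 < s i) ->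
  \prod_i s i = 4 * t + 2 ->
  2 %| s ord0 -> odd (s ord0 %/ 2) ->
  (forall i, i != ord0 -> odd (s i)) ->
  is_binary phi ->
  (exists i, z i) ->
  let EK := EmodK s z in
  let HK := HmodK s z in
  let D := neg_cosets z phi in
  (is_GOBA z phi <-> is_rqds t EK HK D) /\
  (z ord0 = false -> is_GOBA z phi -> is_extremal_rqds t EK HK D).
Proof.
move=> _ s1 prod_s s0e s0o _ phi2 zn EK HK D.
have goba_rqds := GOBA_rqds s1 phi2 prod_s s0e s0o zn.
split; first split.
- move=> g; exists (if z ord0 then neg_zero_cosets z phi else set0).
  exact: goba_rqds.
- by case=> S; apply: (rqds_GOBA s1 phi2 prod_s s0e s0o zn).
- by move=> z0 g; have := goba_rqds g; rewrite z0.
Qed.
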